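(* Let $\mathbb{F}$ be a field, let $n,k\in\mathbb{N}$ with $k<n-k$, and let $$A=\left(\begin{array}{c|c}\mathbf{0}_{k,k} & \mathbf{0}_{k,n-k}\\ \hline \mathbf{0}_{n-k,k} & A_{22}\end{array}\right)\in\mathbb{M}_n(\mathbb{F}),$$ where $A_{22}\in\mathbb{M}_{n-k}(\mathbb{F})$ is an invertible matrix. Then there exist an invertible matrix $T\in\mathbb{M}_n(\mathbb{F})$ and a square-zero matrix $N\in\mathbb{M}_n(\mathbb{F})$ such that $A=T+N$.
   Context: $\mathbb{M}_m(\mathbb{F})$ is the ring of $m\times m$ matrices over $\mathbb{F}$ and $\mathbf{0}_{r,s}$ is the $r\times s$ zero matrix. The value $k=0$ is allowed (then $A=A_{22}$). A matrix $N$ is square-zero if $N^2=0$. *)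

(* Defs.v *)
From mathcomp Require Import all_boot all_order all_algebra.

Set Implicit Arguments.
Unset Strict Implicit.
Unset Printing Implicit Defensive.

Lemma subnKC_half (n k : nat) : k < n - k -> k + (n - k) = n.
Proof. by move=> lt_k; apply/subnKC/ltnW; rewrite -subn_gt0 (leq_ltn_trans _ lt_k). Qed.

Local Open Scope ring_scope.

(* The blocks assemble to a matrix of size k + (n - k), which is only
   propositionally equal to n, hence the cast to 'M_n. *)
Definition zero_diag_block (F : fieldType) (n k : nat) (hk : (k < n - k)%N)
    (A22 : 'M[F]_(n - k)) : 'M[F]_n :=
  castmx (subnKC_half hk, subnKC_half hk)
    (block_mx (0 : 'M_(k, k)) (0 : 'M_(k, n - k)) (0 : 'M_(n - k, k)) A22).

Definition square_zero (F : fieldType) (n : nat) (N : 'M[F]_n) : Prop :=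
  N *m N = 0.

(* Main.v *)
Require Import Defs.
From mathcomp Require Import all_boot all_order all_algebra.

(** Write B for the invertible block [A22], of size m >= k.  A square-zero
    matrix of rank k can be sought as a product of a column (1, P)^T and a row
    (-QP, Q), where P is m x k and Q is k x m: the row times the column is
    -QP + QP = 0 ([square_zero_mul_col_row]).  Subtracting it from diag(0, B)
    leaves [[QP, -Q], [PQP, B - PQ]], and clearing the lower left block by P
    times the first block row gives [[QP, -Q], [0, B]]
    ([block_diag_sub_col_row]).  The difference is therefore invertible as soon
    as QP is, and since k <= m the rectangular partial identities P and Q
    satisfy QP = 1. *)

Import GRing.Theory.

Local Open Scope ring_scope.

(** The two factors of the decomposition below multiply to zero in the reverse
    order, which is what makes their product square-zero. *)
Lemma square_zero_mul_col_row (F : fieldType) (k m : nat)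
    (P : 'M[F]_(m, k)) (Q : 'M[F]_(k, m)) :
  square_zero (col_mx 1%:M P *m row_mx (- (Q *m P)) Q).
Proof.
rewrite /square_zero mulmxA -(mulmxA (col_mx _ _) (row_mx _ _)).
by rewrite mul_row_col mulmx1 addNr mulmx0 mul0mx.
Qed.

(** The difference factors as a unipotent lower triangular block matrix times
    an upper triangular one, so that its determinant is det (QP) * det B. *)
Lemma block_diag_sub_col_row (F : fieldType) (k m : nat)
    (P : 'M[F]_(m, k)) (Q : 'M[F]_(k, m)) (B : 'M[F]_m) :
  block_mx 0 0 0 B - col_mx 1%:M P *m row_mx (- (Q *m P)) Q
    = block_mx 1%:M 0 P 1%:M *m block_mx (Q *m P) (- Q) 0 B.
Proof.
rewrite mul_col_row opp_block_mx add_block_mx mulmx_block.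
rewrite !mul1mx !mul0mx !mulmxN !opprK !add0r !addr0.
by rewrite addrC.
Qed.

Lemma block_diag_unit_add_square_zero (F : fieldType) (k m : nat) (B : 'M[F]_m) :
  (k <= m)%N -> B \in unitmx ->
  exists T N : 'M[F]_(k + m),
    [/\ T \in unitmx, square_zero N & block_mx 0 0 0 B = T + N].
Proof.
move=> le_km unitB.
pose P : 'M[F]_(m, k) := pid_mx k; pose Q : 'M[F]_(k, m) := pid_mx k.
have QP1 : Q *m P = 1%:M.
  by rewrite /Q /P mul_pid_mx minnn (minn_idPr le_km) pid_mx_1.
pose N := col_mx 1%:M P *m row_mx (- (Q *m P)) Q.
exists (block_mx 0 0 0 B - N), N; split; last by rewrite subrK.
- rewrite block_diag_sub_col_row QP1 unitmx_mul !unitmxE.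
  by rewrite det_lblock det_ublock !det1 !mul1r unitr1 -unitmxE.
- exact: square_zero_mul_col_row.
Qed.

Theorem corollary3p2 (F : fieldType) (n k : nat) (hk : (k < n - k)%N)
    (A22 : 'M[F]_(n - k)) (hA22 : A22 \in unitmx) :
  exists T N : 'M[F]_n,
    [/\ T \in unitmx, square_zero N & zero_diag_block hk A22 = T + N].
Proof.
have := block_diag_unit_add_square_zero _ _ _ _ (ltnW hk) hA22.
rewrite /zero_diag_block.
(* The size n - k must become a variable before n can be replaced by k + m. *)
move: (subnKC_half hk) (A22); move: {hk A22 hA22} (n - k)%N => m e B.
by case: n / e; rewrite castmx_id.
Qed.
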